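(* Let $\overline{\mathcal{F}}$ be the filter monad on $\mathbf{Top}$, i.e. the monad induced by the dual adjunction $\mathbf{Top}(-,\mathbb{S})\dashv\mathbf{MSL}(-,2)\colon\mathbf{MSL}^{\mathrm{op}}\to\mathbf{Top}$, so $\overline{\mathcal{F}}X=\mathbf{MSL}(\mathbf{Top}(X,\mathbb{S}),2)$ is the space of filters of open sets of $X$. Then $\overline{\mathcal{F}}$ is the codensity monad of the functor $U_{\mathcal{P}_{\mathsf f}}\colon\mathbf{Kl}_{\mathsf f}(\mathcal{P}_{\mathsf f})\to\mathbf{Top}$ sending $X$ to $\mathbb{S}^X$.
   Context: $\mathbb{S}$ is the Sierpinski space on $\{0,1\}$ with open sets $\emptyset,\{1\},\{0,1\}$. $\mathbf{MSL}$ is the category of meet-semilattices with top and maps preserving finite meets and top; $2$ is the two-element meet-semilattice. $\mathbf{Top}(X,\mathbb{S})$ (equivalently the open sets of $X$) carries the pointwise meet-semilattice structure, and $\mathbf{MSL}(M,2)$ is topologized as a subspace of the product space $\mathbb{S}^{|M|}$. $\mathbf{Kl}_{\mathsf f}(\mathcal{P}_{\mathsf f})$ has as objects finite sets and as morphisms $f\colon X\to\mathcal{P}_{\mathsf f}Y$ (Kleisli composition for the finite power set monad); $U_{\mathcal{P}_{\mathsf f}}$ sends $X$ to the power $\mathbb{S}^X$ (identified with $\mathcal{P}_{\mathsf f}X$ via characteristic maps) and $f$ to $f^\#\colon A\mapsto\bigcup_{x\in A}f(x)$. The codensity monad of a functor $F$ is $\mathrm{Ran}_FF$ with its canonical monad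 structure; ''is the codensity monad'' means isomorphic as monads.
   Formalization: A subset A of X is identified with the map in S^X that is 0 exactly on A (not 1 on A), so the functor acts on S^X by finite meets; with the usual characteristic maps it acts by finite joins and the claim fails already at the one-point space. *)

(* Defs.v *)
From HB Require Import structures.
From mathcomp Require Import all_boot all_order.
From mathcomp Require Import boolp classical_sets functions.
From mathcomp Require Import topology_structure supremum_topology.
From mathcomp Require Import initial_topology function_spaces.

Set Implicit Arguments.
Unset Strict Implicit.
Unset Printing Implicit Defensive.

Import Order.TTheory.
Local Open Scope classical_set_scope.
Local Obligation Tactic := idtac.

Record category := Category {
  obj :> Type;
  hom : obj -> obj -> Type;
  idm : forall A, hom A A;
  comp : forall A B C, hom B C -> hom A B -> hom A C;
  comp1m : forall A B (f : hom A B), comp (idm B) f = f;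
  compm1 : forall A B (f : hom A B), comp f (idm A) = f;
  compmA : forall A B C D (h : hom C D) (g : hom B C) (f : hom A B),
    comp h (comp g f) = comp (comp h g) f }.

Notation "g '\oc' f" := (comp g f) (at level 40, left associativity).

Definition opposite (C : category) : category :=
  @Category C (fun A B => hom B A) (fun A => idm A)
    (fun A B D g f => f \oc g)
    (fun A B f => compm1 f) (fun A B f => comp1m f)
    (fun A B D E h g f => esym (compmA f g h)).

Record functor (C D : category) := Functor {
  fobj :> C -> D;
  fmap : forall A B : C, hom A B -> hom (fobj A) (fobj B);
  fmap_id : forall A : C, fmap (idm A) = idm (fobj A);
  fmap_comp : forall (A B E : C) (g : hom B E) (f : hom A B),
    fmap (g \oc f) = fmap g \oc fmap f }.

Definition id_functor (C : category) : functor C C :=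
  @Functor C C id (fun A B f => f) (fun A => erefl) (fun A B E g f => erefl).

Section CompFunctor.
Variables (C D E : category) (G : functor D E) (F : functor C D).

Let cmap (A B : C) (f : hom A B) : hom (G (F A)) (G (F B)) := fmap G (fmap F f).

Lemma comp_functor_id (A : C) : cmap (idm A) = idm (G (F A)).
Proof. by rewrite /cmap !fmap_id. Qed.

Lemma comp_functor_comp (A B A' : C) (g : hom B A') (f : hom A B) :
  cmap (g \oc f) = cmap g \oc cmap f.
Proof. by rewrite /cmap !fmap_comp. Qed.

Definition comp_functor : functor C E :=
  @Functor C E (fun A => G (F A)) cmap comp_functor_id comp_functor_comp.
End CompFunctor.

Notation "G '\of' F" := (comp_functor G F) (at level 40, left associativity).

Record nattrans (C D : category) (F G : functor C D) := NatTrans {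
  component :> forall A : C, hom (F A) (G A);
  natural : forall (A B : C) (f : hom A B),
    component B \oc fmap F f = fmap G f \oc component A }.

Record monad (C : category) := Monad {
  mfun :> functor C C;
  munit : nattrans (id_functor C) mfun;
  mmult : nattrans (mfun \of mfun) mfun;
  mmult_unitl : forall A, mmult A \oc munit (mfun A) = idm (mfun A);
  mmult_unitr : forall A, mmult A \oc fmap mfun (munit A) = idm (mfun A);
  mmultA : forall A,
    mmult A \oc mmult (mfun A) = mmult A \oc fmap mfun (mmult A) }.

(* The inverse of an invertible monad morphism is again a monad morphism. *)
Definition monads_isomorphic (C : category) (S T : monad C) : Prop :=
  exists (a : nattrans S T) (b : nattrans T S),
    [/\ forall A, b A \oc a A = idm (S A),
        forall A, a A \oc b A = idm (T A),
        forall A, a A \oc munit S A = munit T A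
      & forall A, a A \oc mmult S A = mmult T A \oc a (T A) \oc fmap S (a A)].

Record adjunction (C D : category) (L : functor C D) (R : functor D C) :=
  Adjunction {
  aunit : nattrans (id_functor C) (R \of L);
  acounit : nattrans (L \of R) (id_functor D);
  triangleL : forall A : C, acounit (L A) \oc fmap L (aunit A) = idm (L A);
  triangleR : forall B : D, fmap R (acounit B) \oc aunit (R B) = idm (R B) }.

Section AdjunctionMonad.
Variables (C D : category) (L : functor C D) (R : functor D C).
Variable adj : adjunction L R.

Let T := R \of L.
Let mu (A : C) : hom (T (T A)) (T A) := fmap R (acounit adj (L A)).

Lemma adjunction_mult_natural (A B : C) (f : hom A B) :
  mu B \oc fmap (T \of T) f = fmap T f \oc mu A.
Proof.
by rewrite /mu /= -!fmap_comp; congr (fmap R _); exact: (natural (acounit adj)).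
Qed.

Let mun : nattrans (T \of T) T := NatTrans adjunction_mult_natural.

Lemma adjunction_mult_unitl (A : C) : mun A \oc aunit adj (T A) = idm (T A).
Proof. exact: (triangleR adj (L A)). Qed.

Lemma adjunction_mult_unitr (A : C) :
  mun A \oc fmap T (aunit adj A) = idm (T A).
Proof. by rewrite /= /mu -fmap_comp triangleL fmap_id. Qed.

Lemma adjunction_multA (A : C) : mun A \oc mun (T A) = mun A \oc fmap T (mun A).
Proof.
rewrite /= /mu -!fmap_comp; congr (fmap R _).
exact: esym (natural (acounit adj) (acounit adj (L A))).
Qed.

Definition adjunction_monad : monad C :=
  Monad adjunction_mult_unitl adjunction_mult_unitr adjunction_multA.
End AdjunctionMonad.

Record right_kan_extension (A B C : category) (K : functor A B)
    (F : functor A C) := RightKanExtension {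
  ran :> functor B C;
  ran_eps : nattrans (ran \of K) F;
  ran_lift : forall G : functor B C, nattrans (G \of K) F -> nattrans G ran;
  ran_liftE : forall (G : functor B C) (alpha : nattrans (G \of K) F) (a : A),
    ran_eps a \oc ran_lift alpha (K a) = alpha a;
  ran_lift_unique : forall (G : functor B C) (alpha : nattrans (G \of K) F)
      (beta : nattrans G ran),
    (forall a : A, ran_eps a \oc beta (K a) = alpha a) ->
    forall b : B, beta b = ran_lift alpha b }.

Section CodensityMonad.
Variables (A C : category) (F : functor A C) (R : right_kan_extension F F).

Let T : functor C C := R.
Let eps (a : A) : hom (T (F a)) (F a) := ran_eps R a.

Let eps_natural (a b : A) (f : hom a b) :
  eps b \oc fmap T (fmap F f) = fmap F f \oc eps a.
Proof. exact: (natural (ran_eps R) f). Qed.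

Lemma ran_ext (G : functor C C) (beta gamma : nattrans G T) :
  (forall a, ran_eps R a \oc beta (F a) = ran_eps R a \oc gamma (F a)) ->
  forall X, beta X = gamma X.
Proof.
move=> eq_bg X.
have nat_bF (a b : A) (f : hom a b) :
    (eps b \oc gamma (F b)) \oc fmap G (fmap F f)
    = fmap F f \oc (eps a \oc gamma (F a)).
  by rewrite -compmA (natural gamma) !compmA eps_natural.
pose alpha := @NatTrans _ _ (G \of F) F _ nat_bF.
rewrite (@ran_lift_unique _ _ _ _ _ R G alpha beta) //.
by rewrite (@ran_lift_unique _ _ _ _ _ R G alpha gamma).
Qed.

Lemma codensity_unit_natural (a b : A) (f : hom a b) :
  idm (F b) \oc fmap F f = fmap F f \oc idm (F a).
Proof. by rewrite comp1m compm1. Qed.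

Definition codensity_unit : nattrans (id_functor C) T :=
  @ran_lift _ _ _ _ _ R (id_functor C)
    (@NatTrans _ _ (id_functor C \of F) F (fun a => idm (F a))
      codensity_unit_natural).

Lemma codensity_mult_natural (a b : A) (f : hom a b) :
  (eps b \oc fmap T (eps b)) \oc fmap T (fmap T (fmap F f))
  = fmap F f \oc (eps a \oc fmap T (eps a)).
Proof.
by rewrite -compmA -fmap_comp eps_natural fmap_comp !compmA eps_natural.
Qed.

Definition codensity_mult : nattrans (T \of T) T :=
  @ran_lift _ _ _ _ _ R (T \of T)
    (@NatTrans _ _ (T \of T \of F) F (fun a => eps a \oc fmap T (eps a))
      codensity_mult_natural).

Let eta (X : C) : hom X (T X) := codensity_unit X.
Let mu (X : C) : hom (T (T X)) (T X) := codensity_mult X.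

Let eta_natural (X Y : C) (f : hom X Y) : eta Y \oc f = fmap T f \oc eta X.
Proof. exact: (natural codensity_unit f). Qed.

Let mu_natural (X Y : C) (f : hom X Y) :
  mu Y \oc fmap T (fmap T f) = fmap T f \oc mu X.
Proof. exact: (natural codensity_mult f). Qed.

Let eps_eta (a : A) : eps a \oc eta (F a) = idm (F a).
Proof. exact: (@ran_liftE _ _ _ _ _ R (id_functor C)). Qed.

Let eps_mu (a : A) : eps a \oc mu (F a) = eps a \oc fmap T (eps a).
Proof. exact: (@ran_liftE _ _ _ _ _ R (T \of T)). Qed.

Let id_natural (X Y : C) (f : hom X Y) :
  idm (T Y) \oc fmap T f = fmap T f \oc idm (T X).
Proof. by rewrite comp1m compm1. Qed.

Lemma codensity_mult_unitl (X : C) : mu X \oc eta (T X) = idm (T X).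
Proof.
have nat_l (Y Z : C) (f : hom Y Z) :
    (mu Z \oc eta (T Z)) \oc fmap T f = fmap T f \oc (mu Y \oc eta (T Y)).
  by rewrite -compmA eta_natural !compmA mu_natural.
apply: (@ran_ext T (NatTrans nat_l) (NatTrans id_natural)) => a.
change (eps a \oc (mu (F a) \oc eta (T (F a))) = eps a \oc idm (T (F a))).
by rewrite compmA eps_mu -compmA -eta_natural compmA eps_eta comp1m compm1.
Qed.

Lemma codensity_mult_unitr (X : C) : mu X \oc fmap T (eta X) = idm (T X).
Proof.
have nat_r (Y Z : C) (f : hom Y Z) :
    (mu Z \oc fmap T (eta Z)) \oc fmap T f
    = fmap T f \oc (mu Y \oc fmap T (eta Y)).
  by rewrite -compmA -fmap_comp eta_natural fmap_comp !compmA mu_natural.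
apply: (@ran_ext T (NatTrans nat_r) (NatTrans id_natural)) => a.
change (eps a \oc (mu (F a) \oc fmap T (eta (F a))) = eps a \oc idm (T (F a))).
by rewrite compmA eps_mu -compmA -fmap_comp eps_eta fmap_id.
Qed.

Lemma codensity_multA (X : C) : mu X \oc mu (T X) = mu X \oc fmap T (mu X).
Proof.
have nat_1 (Y Z : C) (f : hom Y Z) :
    (mu Z \oc mu (T Z)) \oc fmap T (fmap T (fmap T f))
    = fmap T f \oc (mu Y \oc mu (T Y)).
  by rewrite -compmA mu_natural !compmA mu_natural.
have nat_2 (Y Z : C) (f : hom Y Z) :
    (mu Z \oc fmap T (mu Z)) \oc fmap T (fmap T (fmap T f))
    = fmap T f \oc (mu Y \oc fmap T (mu Y)).
  by rewrite -compmA -fmap_comp mu_natural fmap_comp !compmA mu_natural.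
apply: (@ran_ext (T \of T \of T) (@NatTrans _ _ (T \of T \of T) T _ nat_1)
  (@NatTrans _ _ (T \of T \of T) T _ nat_2)) => a.
change (eps a \oc (mu (F a) \oc mu (T (F a)))
  = eps a \oc (mu (F a) \oc fmap T (mu (F a)))).
rewrite !compmA eps_mu -[RHS]compmA -fmap_comp eps_mu fmap_comp compmA.
by rewrite -[in RHS]eps_mu -[RHS]compmA mu_natural compmA.
Qed.

Definition codensity_monad : monad C :=
  @Monad C T codensity_unit codensity_mult
    codensity_mult_unitl codensity_mult_unitr codensity_multA.
End CodensityMonad.

Definition is_codensity_monad (A C : category) (T : monad C)
    (F : functor A C) : Prop :=
  exists R : right_kan_extension F F, monads_isomorphic T (codensity_monad R).

Definition top_comp (X Y Z : topologicalType) (g : continuousType Y Z)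
  (f : continuousType X Y) : continuousType X Z := g \o f.

(* The choice operator bundled in a [topologicalType] is invisible to
   continuous maps, and every type has one (classically), so this category is
   equivalent to that of bare topological spaces; spaces may be empty. *)
Program Definition Top : category :=
  @Category topologicalType (fun X Y => continuousType X Y)
    (fun X => idfun : continuousType X X) top_comp _ _ _.
Next Obligation. by move=> X Y f; apply/continuousEP. Qed.
Next Obligation. by move=> X Y f; apply/continuousEP. Qed.
Next Obligation. by move=> X Y Z T h g f; apply/continuousEP. Qed.

Definition sierpinski : Type := bool.

HB.instance Definition _ := Choice.on sierpinski.

Definition sierpinski_open : set (set sierpinski) :=
  [set A | [\/ A = set0, A = [set true] | A = setT]].

Lemma sierpinski_openE (A : set sierpinski) :
  sierpinski_open A <-> (A false -> A true).
Proof.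
split=> [[->|->|->]//|A01].
have [A1|nA1] := pselect (A true); last first.
  by apply: Or31; apply/seteqP; split=> // -[/nA1|/A01/nA1].
have [A0|nA0] := pselect (A false).
  by apply: Or33; apply/seteqP; split=> // -[].
by apply: Or32; apply/seteqP; split=> [[//|/nA0//]|_ ->].
Qed.

Lemma sierpinski_openT : sierpinski_open setT.
Proof. exact: Or33. Qed.

Lemma sierpinski_openI : setI_closed sierpinski_open.
Proof.
move=> A B /sierpinski_openE A01 /sierpinski_openE B01.
by apply/sierpinski_openE => -[/A01 ? /B01 ?]; split.
Qed.

Lemma sierpinski_open_bigU (I : Type) (f : I -> set sierpinski) :
  (forall i, sierpinski_open (f i)) -> sierpinski_open (\bigcup_i f i).
Proof.
move=> of_; apply/sierpinski_openE => -[i _ fi0].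
by exists i => //; move/sierpinski_openE: (of_ i); apply.
Qed.

HB.instance Definition _ := isOpenTopological.Build sierpinski
  sierpinski_openT sierpinski_openI sierpinski_open_bigU.

(* The display only controls notations; it is packed with the object so that
   lattices declared with any display belong to the category. *)
Record msl := Msl {
  msl_disp : Order.disp_t;
  msl_sort :> tMeetSemilatticeType msl_disp }.

Record msl_hom (M N : msl) := MslHom {
  msl_fun :> M -> N;
  msl_meet : forall x y : M, msl_fun (x `&` y)%O = (msl_fun x `&` msl_fun y)%O;
  msl_top : msl_fun \top%O = \top%O }.

Lemma msl_homEP (M N : msl) (f g : msl_hom M N) : f = g <-> f =1 g.
Proof.
split=> [->//|]; case: f g => [f f1 f2] [g g1 g2] /= /funext fg.
by subst g; congr MslHom; exact: Prop_irrelevance.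
Qed.

HB.instance Definition _ (M N : msl) := gen_eqMixin (msl_hom M N).
HB.instance Definition _ (M N : msl) := gen_choiceMixin (msl_hom M N).

Definition msl_id (M : msl) : msl_hom M M :=
  @MslHom M M id (fun _ _ => erefl) erefl.

Program Definition msl_comp (M N P : msl) (g : msl_hom N P) (f : msl_hom M N) :
  msl_hom M P := @MslHom M P (fun x => g (f x)) _ _.
Next Obligation. by move=> M N P g f x y /=; rewrite !msl_meet. Qed.
Next Obligation. by move=> M N P g f /=; rewrite !msl_top. Qed.

Program Definition MSL : category :=
  @Category msl msl_hom msl_id msl_comp _ _ _.
Next Obligation. by move=> M N f; apply/msl_homEP. Qed.
Next Obligation. by move=> M N f; apply/msl_homEP. Qed.
Next Obligation. by move=> M N P Q h g f; apply/msl_homEP. Qed.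

Definition two : msl := Msl bool.

Fact opens_display : Order.disp_t. Proof. exact: Order.Disp tt tt. Qed.

(* [Top(X, S)] with the pointwise order. *)
Section Opens.
Variable X : topologicalType.

Definition opens : Type := continuousType X sierpinski.

HB.instance Definition _ := Choice.on opens.

Implicit Types u v w : opens.

Definition opens_le u v : bool := `[< forall x, (u x : bool) ==> v x >].

Lemma opens_continuous (f : X -> sierpinski) :
  open [set x | f x] -> continuous f.
Proof.
move=> fop; apply/continuousP => A [->|->|->].
- by rewrite preimage_set0; exact: open0.
- exact: fop.
- by rewrite preimage_setT; exact: openT.
Qed.

Lemma opens_open u : open [set x | u x].
Proof.
have /continuousP := @cts_fun _ _ u; apply.
exact: Or32.
Qed.

Lemma opens_meet_continuous u v :
  continuous (fun x => (u x && v x : sierpinski)).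
Proof.
apply: opens_continuous.
rewrite (_ : [set _ | _] = [set x | u x] `&` [set x | v x]).
  by apply: openI; exact: opens_open.
by apply/seteqP; split=> x /= /andP.
Qed.

Definition opens_meet u v : opens := mkcts (@opens_meet_continuous u v).

Definition opens_top : opens :=
  mkcts (fun x => @cst_continuous X sierpinski true x).

Lemma opens_le_refl : reflexive opens_le.
Proof. by move=> u; apply/asboolP => x; exact: implybb. Qed.

Lemma opens_le_anti : antisymmetric opens_le.
Proof.
move=> u v /andP[/asboolP uv /asboolP vu]; apply/continuousEP => x.
by move: (uv x) (vu x); case: (u x); case: (v x).
Qed.

Lemma opens_le_trans : transitive opens_le.
Proof.
move=> v u w /asboolP uv /asboolP vw; apply/asboolP => x.
by apply/implyP => /(implyP (uv x)); exact/implyP.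
Qed.

HB.instance Definition _ := Order.Le_isPOrder.Build opens_display opens
  opens_le_refl opens_le_anti opens_le_trans.

Lemma opens_lexI u v w :
  opens_le u (opens_meet v w) = opens_le u v && opens_le u w.
Proof.
apply/asboolP/andP => [uvw|[/asboolP uv /asboolP uw] x].
  by split; apply/asboolP => x; apply/implyP => /(implyP (uvw x))/andP[].
apply/implyP => ux; apply/andP.
by split; [exact: implyP (uv x) _ | exact: implyP (uw x) _].
Qed.

HB.instance Definition _ :=
  Order.POrder_isMeetSemilattice.Build opens_display opens opens_lexI.

Lemma opens_lex1 u : opens_le u opens_top.
Proof. by apply/asboolP => x; apply/implyP. Qed.

HB.instance Definition _ :=
  Order.hasTop.Build opens_display opens opens_lex1.
End Opens.

Program Definition opens_map (X Y : topologicalType) (f : continuousType X Y) :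
    msl_hom (Msl (opens Y)) (Msl (opens X)) :=
  @MslHom (Msl (opens Y)) (Msl (opens X))
    (fun u => top_comp u f : opens X) _ _.
Next Obligation. by move=> X Y f u v; apply/continuousEP. Qed.
Next Obligation. by move=> X Y f; apply/continuousEP. Qed.

Program Definition opens_functor : functor Top (opposite MSL) :=
  @Functor Top (opposite MSL) (fun X => Msl (opens X)) opens_map _ _.
Next Obligation. by move=> X; apply/msl_homEP => u; apply/continuousEP. Qed.
Next Obligation.
by move=> X Y Z g f; apply/msl_homEP => u; apply/continuousEP.
Qed.

(* [MSL(M, 2)] as a subspace of the power of the Sierpinski space. *)
Definition points (M : msl) : Type := msl_hom M two.

Definition points_incl (M : msl) (p : points M) : {ptws M -> sierpinski} :=
  fun m => p m.

HB.instance Definition _ (M : msl) := Choice.on (points M).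
HB.instance Definition _ (M : msl) :=
  Topological.copy (points M) (initial_topology (@points_incl M)).

Lemma continuous_ptws (T : topologicalType) (I : Type)
    (f : T -> {ptws I -> sierpinski}) :
  (forall i, continuous (fun t => f t i)) -> continuous f.
Proof.
move=> cf t; apply/cvg_sup => i.
apply: (@continuous_comp_initial _ _ _ (fun g : I -> sierpinski => g i) f).
exact: cf.
Qed.

Lemma ptws_proj_continuous (I : eqType) (i : I) :
  continuous (fun f : {ptws I -> sierpinski} => f i).
Proof. exact: (@proj_continuous I (fun=> sierpinski) i). Qed.

Lemma points_eval_continuous (M : msl) (m : M) :
  continuous (fun p : points M => (p m : sierpinski)).
Proof.
move=> p; apply: (@continuous_comp (points M) {ptws M -> sierpinski} sierpinski
  (@points_incl M) (fun f => f m)).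
  exact: initial_continuous.
exact: ptws_proj_continuous.
Qed.

Lemma points_continuous (X : topologicalType) (M : msl) (f : X -> points M) :
  (forall m, continuous (fun x => (f x m : sierpinski))) -> continuous f.
Proof.
move=> cf; apply: (@continuous_comp_initial _ _ _ (@points_incl M)).
exact: (@continuous_ptws X M).
Qed.

Lemma points_map_continuous (M N : msl) (g : msl_hom N M) :
  continuous (fun p : points M => (msl_comp p g : points N)).
Proof. by apply: points_continuous => n; exact: points_eval_continuous. Qed.

Definition points_map (M N : msl) (g : msl_hom N M) :
  continuousType (points M) (points N) := mkcts (@points_map_continuous M N g).

Program Definition points_functor : functor (opposite MSL) Top :=
  @Functor (opposite MSL) Top (fun M => points M) points_map _ _.
Next Obligation. by move=> M; apply/continuousEP => p; apply/msl_homEP. Qed.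
Next Obligation.
by move=> M N P g f; apply/continuousEP => p; apply/msl_homEP.
Qed.

Section DualAdjunction.

Section Unit.
Variable X : topologicalType.

Program Definition dual_unit_fun (x : X) : points (Msl (opens X)) :=
  @MslHom (Msl (opens X)) two (fun u : opens X => u x : bool) _ _.
Next Obligation. by []. Qed.
Next Obligation. by []. Qed.

Lemma dual_unit_continuous : continuous dual_unit_fun.
Proof. by apply: points_continuous => u; exact: cts_fun. Qed.

Definition dual_unit_map : continuousType X (points (Msl (opens X))) :=
  mkcts dual_unit_continuous.
End Unit.

Program Definition dual_unit :
    nattrans (id_functor Top) (points_functor \of opens_functor) :=
  @NatTrans Top Top (id_functor Top) (points_functor \of opens_functor)
    dual_unit_map _.
Next Obligation.
by move=> X Y f; apply/continuousEP => x; apply/msl_homEP.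
Qed.

Section Counit.
Variable M : msl.

Definition dual_counit_fun (m : M) : opens (points M) :=
  mkcts (@points_eval_continuous M m).

Program Definition dual_counit_map : msl_hom M (Msl (opens (points M))) :=
  @MslHom M (Msl (opens (points M))) dual_counit_fun _ _.
Next Obligation.
by move=> x y; apply/continuousEP => p; exact: (msl_meet (p : points M) x y).
Qed.
Next Obligation.
by apply/continuousEP => p; exact: (msl_top (p : points M)).
Qed.
End Counit.

Program Definition dual_counit :
    nattrans (opens_functor \of points_functor) (id_functor (opposite MSL)) :=
  @NatTrans _ _ (opens_functor \of points_functor) (id_functor (opposite MSL))
    dual_counit_map _.
Next Obligation.
by move=> M N f; apply/msl_homEP => m; apply/continuousEP.
Qed.

Program Definition dual_adjunction :
    adjunction opens_functor points_functor :=
  @Adjunction Top (opposite MSL) _ _ dual_unit dual_counit _ _.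
Next Obligation. by move=> X; apply/msl_homEP => u; apply/continuousEP. Qed.
Next Obligation. by move=> M; apply/continuousEP => p; apply/msl_homEP. Qed.
End DualAdjunction.

Definition filter_monad : monad Top := adjunction_monad dual_adjunction.

(* Every subset of a finite set is finite, so [{set Y}] is the finite power set
   of [Y : finType]. *)
Section KleisliExtension.
Variables X Y : finType.

Definition kl_ext (f : X -> {set Y}) (A : {set X}) : {set Y} :=
  (\bigcup_(x in A) f x)%SET.
End KleisliExtension.

Lemma kl_ext1 (X : finType) (A : {set X}) : kl_ext (fun x => [set x]%SET) A = A.
Proof.
apply/setP => y; apply/bigcupP/idP => [[x xA]|yA].
  by rewrite inE => /eqP ->.
by exists y => //; rewrite inE.
Qed.

Lemma kl_ext_set1 (X Y : finType) (f : X -> {set Y}) (x : X) :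
  kl_ext f [set x]%SET = f x.
Proof. by rewrite /kl_ext big_set1. Qed.

Lemma kl_ext_comp (X Y Z : finType) (g : Y -> {set Z}) (f : X -> {set Y})
    (A : {set X}) :
  kl_ext (fun x => kl_ext g (f x)) A = kl_ext g (kl_ext f A).
Proof.
apply/setP => z; apply/bigcupP/bigcupP => [[x xA /bigcupP[y yfx zgy]]|].
  by exists y => //; apply/bigcupP; exists x.
by move=> [y /bigcupP[x xA yfx] zgy]; exists x => //; apply/bigcupP; exists y.
Qed.

Program Definition Kl_Pf : category :=
  @Category finType (fun X Y => X -> {set Y}) (fun X x => [set x]%SET)
    (fun X Y Z g f x => kl_ext g (f x)) _ _ _.
Next Obligation. by move=> X Y f; apply/funext => x; exact: kl_ext1. Qed.
Next Obligation. by move=> X Y f; apply/funext => x; exact: kl_ext_set1. Qed.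
Next Obligation.
by move=> X Y Z T h g f; apply/funext => x /=; rewrite kl_ext_comp.
Qed.

(* A subset [A] of [X] is identified with its characteristic map in the
   convention where the value is 0 (= [false]) exactly on [A], that is, with
   the semilattice isomorphism between the free meet-semilattice on [X]
   (subsets with union as meet and the empty set as top) and the power of 2
   with pointwise meet.  The functor then acts by the finite meets
   [y |-> /\_(x | y \in f x) s x].  Under the convention with value 1 on [A] it
   would act by finite joins instead, and its codensity monad would consist of
   the maps from open sets to 2 preserving finite joins, not of filters. *)
Section CharacteristicMaps.
Variable X : finType.

Definition char_map (A : {set X}) : {ptws X -> sierpinski} :=
  fun x => x \notin A.

Definition set_of_char_map (s : {ptws X -> sierpinski}) : {set X} :=
  [set x | ~~ s x]%SET.

Lemma char_mapK : cancel char_map set_of_char_map.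
Proof. by move=> A; apply/setP => x; rewrite inE negbK. Qed.

Lemma set_of_char_mapK : cancel set_of_char_map char_map.
Proof. by move=> s; apply/funext => x; rewrite /char_map inE negbK. Qed.
End CharacteristicMaps.

Section PowerMap.
Variables (X Y : finType) (f : X -> {set Y}).

Definition power_fun (s : {ptws X -> sierpinski}) : {ptws Y -> sierpinski} :=
  char_map (kl_ext f (set_of_char_map s)).

Lemma power_funE s y : power_fun s y = [forall (x | y \in f x), s x].
Proof.
rewrite /power_fun /char_map; apply/idP/forall_inP => [ys x yfx|ys].
  apply: contraR ys => nsx; apply/bigcupP; exists x => //.
  by rewrite inE.
by apply/bigcupP => -[x]; rewrite inE => nsx /ys; exact/negP.
Qed.

Lemma power_continuous : continuous power_fun.
Proof.
apply: continuous_ptws => y; apply: opens_continuous.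
rewrite openE => s /=; rewrite power_funE => /forall_inP sP.
have sN x : \forall t \near s, y \in f x -> (t : {ptws X -> sierpinski}) x.
  have [yfx|/negP nyfx] := boolP (y \in f x); last by near=> t.
  near=> t => _; near: t; apply: open_nbhs_nbhs; split; last exact: sP.
  exact: (opens_open (mkcts (@ptws_proj_continuous X x))).
have := @filter_forall _ _ _ _ (nbhs_filter s) sN.
by apply: filterS => t tP /=; rewrite power_funE; apply/forall_inP.
Unshelve. all: by end_near. Qed.

Definition power_map :
    continuousType {ptws X -> sierpinski} {ptws Y -> sierpinski} :=
  mkcts power_continuous.
End PowerMap.

Program Definition U_Pf : functor Kl_Pf Top :=
  @Functor Kl_Pf Top (fun X : finType => {ptws X -> sierpinski}) power_map _ _.
Next Obligation.
move=> X; apply/continuousEP => s.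
by rewrite /= /mkcts /power_fun kl_ext1 set_of_char_mapK.
Qed.
Next Obligation.
move=> X Y Z g f; apply/continuousEP => s.
by rewrite /= /mkcts /power_fun char_mapK kl_ext_comp.
Qed.

(* Main.v *)
(* The point is that [S] is the power [S^unit] and that the maps [S^X -> S]
   in the image of [U_Pf] are exactly the finite meets of projections.  Given
   [alpha : G U_Pf -> U_Pf], an element [g] of [G Y] sends an open set
   [u : Y -> S] to [alpha_unit (G u g)]; naturality of [alpha] at the
   projections [S^2 -> S], the binary meet [S^2 -> S] and the empty meet
   [S^0 -> S] makes this assignment a filter.  Conversely the value of any
   transformation into filters at [u] is determined by naturality in [u]. *)
From mathcomp Require Import all_boot all_order.
From mathcomp Require Import boolp classical_sets functions.
From mathcomp Require Import topology_structure function_spaces.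
Require Import Defs.

Set Implicit Arguments.
Unset Strict Implicit.
Unset Printing Implicit Defensive.

Definition power_proj (X : finType) (x : X) : opens {ptws X -> sierpinski} :=
  mkcts (@ptws_proj_continuous X x).

(** Evaluation at [s] turns meets of opens into conjunctions, so [power_funE] gives the equality
    pointwise. *)
Lemma power_proj_map (X Y : finType) (f : X -> {set Y}) (y : Y) :
  (top_comp (power_proj y) (power_map f) : opens _) =
  (\meet_(x | y \in f x) power_proj x)%O.
Proof.
apply/continuousEP => s.
rewrite (big_morph (fun u : opens {ptws X -> sierpinski} => (u s : bool))
  (id1 := true) (op1 := andb)) //.
by rewrite big_andE; exact: power_funE.
Qed.

(** The universal transformation of the Kan extension: a filter is tested on the subbasic opens
    only. *)
Definition filter_eps_fun (X : finType)
    (p : points (Msl (opens {ptws X -> sierpinski}))) : {ptws X -> sierpinski} :=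
  fun x => p (power_proj x).

Lemma filter_eps_continuous (X : finType) : continuous (@filter_eps_fun X).
Proof. by apply: continuous_ptws => x; exact: points_eval_continuous. Qed.

Definition filter_eps_map (X : finType) :
    hom (filter_monad (U_Pf X)) (U_Pf X) := mkcts (@filter_eps_continuous X).

Lemma filter_eps_natural (X Y : Kl_Pf) (f : hom X Y) :
  filter_eps_map Y \oc fmap (filter_monad \of U_Pf) f =
  fmap U_Pf f \oc filter_eps_map X.
Proof.
apply/continuousEP => p; apply/funext => y.
transitivity (p (top_comp (power_proj y) (power_map f) : opens _) : bool) => //.
rewrite power_proj_map.
(* Naturality is exactly preservation of finite meets by the filter [p]. *)
rewrite (big_morph (p : _ -> bool) (id1 := true) (op1 := andb)
  (msl_meet p) (msl_top p)).
by rewrite big_andE; exact: esym (power_funE _ _ _).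
Qed.

Definition filter_eps : nattrans (filter_monad \of U_Pf) U_Pf :=
  NatTrans filter_eps_natural.

Section PowerTuple.
Variables (Y : topologicalType) (X : finType) (u : X -> opens Y).

Lemma power_tuple_continuous :
  continuous (fun y => (fun x => u x y) : {ptws X -> sierpinski}).
Proof. by apply: continuous_ptws => x; exact: cts_fun. Qed.

Definition power_tuple : @hom Top Y (U_Pf X) := mkcts power_tuple_continuous.
End PowerTuple.

Section FilterLift.
Variables (G : functor Top Top) (alpha : nattrans (G \of U_Pf) U_Pf).

Definition lift_val (Y : topologicalType) (g : G Y) (u : opens Y) : bool :=
  alpha unit (fmap G (power_tuple (fun _ : unit => u)) g) tt.

(** The hypothesis factors [u] as [h] followed by the image of [f] under [U_Pf]; naturality of
    [alpha] at [f] then moves the meet outside. *)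
Lemma lift_val_map (X : finType) (f : X -> {set unit}) (Y : topologicalType)
    (h : @hom Top Y (U_Pf X)) (g : G Y) (u : opens Y) :
    (forall y, u y = [forall (x | tt \in f x), h y x] :> bool) ->
  lift_val g u = [forall (x | tt \in f x), alpha X (fmap G h g) x].
Proof.
move=> uE; rewrite /lift_val.
have -> : power_tuple (fun=> u) = @fmap _ _ U_Pf X unit f \oc h.
  apply/continuousEP => y; apply/funext => -[].
  exact: etrans (uE y) (esym (power_funE _ _ _)).
rewrite fmap_comp.
have /continuousEP/(_ (fmap G h g)) /= E :=
  natural alpha (f : @hom Kl_Pf X unit).
by rewrite -(power_funE f); exact: (congr1 (fun s => s tt) E).
Qed.

Lemma lift_val_proj (X : finType) (Y : topologicalType)
    (h : @hom Top Y (U_Pf X)) (g : G Y) (x : X) :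
  lift_val g (top_comp (power_proj x) h) = alpha X (fmap G h g) x.
Proof.
have oneE (F : X -> bool) :
    [forall (z | tt \in (if z == x then [set tt] else finset.set0)%SET), F z] = F x.
  apply/forall_inP/idP => [/(_ x)|Fx z]; first by rewrite eqxx inE; apply.
  by case: eqP => [->|_]; rewrite inE.
(* This Kleisli map represents the projection at [x], a meet with a single factor. *)
by rewrite (@lift_val_map X (fun z => if z == x then [set tt] else finset.set0)%SET
  Y h) => [|y]; rewrite oneE.
Qed.

Lemma lift_val_meet (Y : topologicalType) (g : G Y) (u v : opens Y) :
  lift_val g (u `&` v)%O = lift_val g u && lift_val g v.
Proof.
have andE (F : bool -> bool) :
    [forall (b | tt \in [set tt]%SET), F b] = F true && F false.
  apply/forall_inP/andP => [F1|[Ft Ff] [] //].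
  by split; apply: F1; rewrite inE.
(* The pairing of [u] and [v]; the constant map at [[set tt]] then represents the binary meet. *)
pose h := power_tuple (fun b : bool => if b then u else v).
rewrite (@lift_val_map bool (fun=> [set tt]%SET) Y h) => [|y]; rewrite andE //.
by rewrite -!lift_val_proj; congr (lift_val g _ && lift_val g _);
  apply/continuousEP.
Qed.

Lemma lift_val_top (Y : topologicalType) (g : G Y) : lift_val g \top%O = true.
Proof.
have noneE (F : void -> bool) : [forall (x | tt \in finset.set0), F x] = true.
  by apply/forall_inP => -[].
(* The empty meet, precomposed with the only map from [Y] to the one-point power over [void]. *)
by rewrite (@lift_val_map void (fun=> finset.set0) Y
  (power_tuple (of_void (opens Y)))) => [|y]; rewrite noneE.
Qed.

Definition filter_lift_fun (Y : topologicalType) (g : G Y) :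
    points (Msl (opens Y)) :=
  @MslHom (Msl (opens Y)) two (lift_val g) (lift_val_meet g) (lift_val_top g).

Lemma filter_lift_continuous (Y : topologicalType) :
  continuous (@filter_lift_fun Y).
Proof.
apply: points_continuous => u.
exact: (@cts_fun _ _ (top_comp (power_proj tt)
  (alpha unit \oc fmap G (power_tuple (fun=> u))))).
Qed.

Definition filter_lift_map (Y : Top) : hom (G Y) (filter_monad Y) :=
  mkcts (@filter_lift_continuous Y).

Lemma filter_lift_natural (Y Z : Top) (f : hom Y Z) :
  filter_lift_map Z \oc fmap G f = fmap filter_monad f \oc filter_lift_map Y.
Proof.
apply/continuousEP => g; apply/msl_homEP => u.
change (lift_val (fmap G f g) u = lift_val g (top_comp u f)).
rewrite /lift_val.
have -> : power_tuple (fun _ : unit => top_comp u f) =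
    power_tuple (fun=> u) \oc f.
  exact/continuousEP.
by rewrite fmap_comp.
Qed.

Definition filter_lift : nattrans G filter_monad := NatTrans filter_lift_natural.

Lemma filter_liftE (X : Kl_Pf) : filter_eps X \oc filter_lift (U_Pf X) = alpha X.
Proof.
apply/continuousEP => g; apply/funext => x.
change (lift_val g (power_proj x) = alpha X g x).
(* The identity is inserted to play the role of [h] in [lift_val_proj]. *)
have -> : power_proj x = top_comp (power_proj x) (idm (U_Pf X)).
  exact/continuousEP.
by rewrite lift_val_proj fmap_id.
Qed.

Lemma filter_lift_unique (beta : nattrans G filter_monad) :
    (forall X : Kl_Pf, filter_eps X \oc beta (U_Pf X) = alpha X) ->
  forall Y : Top, beta Y = filter_lift Y.
Proof.
move=> betaE Y; apply/continuousEP => g; apply/msl_homEP => u.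
change (beta Y g u = lift_val g u); rewrite /lift_val -betaE.
pose h := power_tuple (fun _ : unit => u).
have /continuousEP/(_ g) E := natural beta h.
(* [u] is the pullback of the generic open [power_proj tt] along [h]. *)
transitivity (fmap filter_monad h (beta Y g) (power_proj tt)).
  by congr (beta Y g _); apply/continuousEP.
exact: (congr1 (fun p : points (Msl (opens {ptws unit -> sierpinski})) =>
  p (power_proj tt) : bool) (esym E)).
Qed.
End FilterLift.

Definition filter_ran : right_kan_extension U_Pf U_Pf :=
  RightKanExtension filter_liftE filter_lift_unique.

Lemma filter_unitE (X : Top) :
  munit filter_monad X = munit (codensity_monad filter_ran) X.
Proof. by apply/continuousEP => x; apply/msl_homEP. Qed.

(** By uniqueness of lifts it suffices to compare after [filter_eps], where both sides evaluate [p]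
    at the open of filters containing [power_proj y]. *)
Lemma filter_multE (X : Top) :
  mmult filter_monad X = mmult (codensity_monad filter_ran) X.
Proof.
apply: (@filter_lift_unique (filter_monad \of filter_monad)) => Y.
by apply/continuousEP => p; apply/funext => y; congr (p _); apply/continuousEP.
Qed.

Lemma id_nattrans_natural (C D : category) (F : functor C D) (A B : C)
    (f : hom A B) :
  idm (F B) \oc fmap F f = fmap F f \oc idm (F A).
Proof. by rewrite comp1m compm1. Qed.

Definition id_nattrans (C D : category) (F : functor C D) : nattrans F F :=
  NatTrans (@id_nattrans_natural C D F).

Theorem theorem4p4 : is_codensity_monad filter_monad U_Pf.
Proof.
exists filter_ran.
(* The Kan extension has the filter functor itself as underlying functor, so only units and
   multiplications remain to be compared. *)
exists (id_nattrans filter_monad), (id_nattrans filter_monad).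
split=> X; rewrite ?comp1m //.
- exact: filter_unitE.
- rewrite [fmap _ _](fmap_id filter_monad) !compm1.
  exact: filter_multE.
Qed.
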